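(* Let $A$ be a unital Banach algebra (over $\mathbb{R}$ or $\mathbb{C}$) for which the set ${\rm GL}\,A$ of invertible elements is dense in $A$. Then $A$ has weakly open multiplication.
   Context: A Banach algebra is a real or complex Banach space with an associative (bilinear) multiplication satisfying $\|ab\|\leqslant\|a\|\,\|b\|$. A map $T\colon X\to Y$ between metric spaces is weakly open if for every non-empty open set $U\subseteq X$ the image $T[U]$ has non-empty interior. $A$ has weakly open multiplication if the map $A\times A\to A$, $(a,b)\mapsto ab$, is weakly open (where $A\times A$ has the product topology). *)

(* Defs.v *)
From HB Require Import structures.
From mathcomp Require Import all_boot all_order all_algebra.
From mathcomp Require Import all_classical all_reals all_analysis.
From mathcomp Require Export complex.

Set Implicit Arguments.
Unset Strict Implicit.
Unset Printing Implicit Defensive.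

Import Order.TTheory GRing.Theory Num.Theory.
Import numFieldNormedType.Exports.

Local Open Scope classical_set_scope.
Local Open Scope ring_scope.

(* The product is a fresh operation [bmul], not the ring product [*%R]: a
   Banach algebra need not be unital, and Hierarchy Builder rejects a join of
   [pzRingType] (or [algType]) with [normedModType], since [numDomainType]
   already inherits from both a ring and a normed structure. *)
HB.mixin Record isBanachAlgebra (K : numFieldType) A
    of CompleteNormedModule K A := {
  bmul : A -> A -> A ;
  bmulA : forall x y z : A, bmul x (bmul y z) = bmul (bmul x y) z ;
  bmulDl : forall x y z : A, bmul (x + y) z = bmul x z + bmul y z ;
  bmulDr : forall x y z : A, bmul x (y + z) = bmul x y + bmul x z ;
  bscalerAl : forall (k : K) (x y : A), k *: bmul x y = bmul (k *: x) y ;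
  bscalerAr : forall (k : K) (x y : A), k *: bmul x y = bmul x (k *: y) ;
  ler_norm_bmul : forall x y : A, `|bmul x y| <= `|x| * `|y|
}.

#[short(type="banachAlgType")]
HB.structure Definition BanachAlgebra (K : numFieldType) :=
  {A of isBanachAlgebra K A & CompleteNormedModule K A}.

(* Neither [`|bone| = 1] nor [bone != 0] is required. *)
HB.mixin Record BanachAlgebra_isUnital (K : numFieldType) A
    of BanachAlgebra K A := {
  bone : A ;
  bmul1l : forall x : A, bmul bone x = x ;
  bmul1r : forall x : A, bmul x bone = x
}.

#[short(type="unitalBanachAlgType")]
HB.structure Definition UnitalBanachAlgebra (K : numFieldType) :=
  {A of BanachAlgebra_isUnital K A & BanachAlgebra K A}.

Definition GL (K : numFieldType) (A : unitalBanachAlgType K) : set A :=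
  [set a | exists b, bmul a b = bone /\ bmul b a = bone].

Arguments GL {K} A _.

Definition weakly_open (X Y : topologicalType) (f : X -> Y) : Prop :=
  forall U : set X, open U -> U !=set0 -> interior (f @` U) !=set0.

Definition weakly_open_multiplication (K : numFieldType)
    (A : banachAlgType K) : Prop :=
  weakly_open (fun p : A * A => bmul p.1 p.2).

(* Main.v *)
Require Import Defs.
From mathcomp Require Import all_boot all_order all_algebra.
From mathcomp Require Import all_classical all_reals all_analysis.

Import Order.TTheory GRing.Theory Num.Theory.
Import numFieldNormedType.Exports.

Local Open Scope classical_set_scope.
Local Open Scope ring_scope.

(** For an invertible [a] with [(a, b)] in the open set [U], left multiplication
    by [a] is a homeomorphism, so it maps the slice [{y | (a, y) \in U}] onto an
    open neighbourhood of [ab]; density of the invertible elements provides such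
    a pair in every non-empty open [U]. *)

Lemma bmulBr (K : numFieldType) (A : banachAlgType K) (c x y : A) :
  bmul c (x - y) = bmul c x - bmul c y.
Proof. by rewrite bmulDr -scaleN1r -bscalerAr scaleN1r. Qed.

Lemma continuous_bmulr (K : numFieldType) (A : banachAlgType K) (c : A) :
  continuous (bmul c).
Proof.
move=> x; apply/cvgrPdist_lt => e e0.
(* Adding 1 keeps the divisor of [e] positive even when [c] is 0. *)
have c1 : 0 < `|c| + 1 by rewrite ltr_wpDl.
near=> y.
rewrite -bmulBr (le_lt_trans (ler_norm_bmul _ _))//.
apply: (@le_lt_trans _ _ ((`|c| + 1) * `|x - y|)).
  by rewrite ler_wpM2r// lerDl.
rewrite mulrC -ltr_pdivlMr//.
by near: y; apply: cvgr_dist_lt; [exact: cvg_id|exact: divr_gt0].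
Unshelve. all: by end_near. Qed.

(** A general [K] covers the real and complex cases at once. *)
Lemma dense_GL_weakly_open_multiplication (K : numFieldType)
    (A : unitalBanachAlgType K) :
  dense (GL A) -> weakly_open_multiplication A.
Proof.
move=> GLdense U Uopen [[a0 b] Uab0].
(* The slice of [U] at second coordinate [b] is open and contains [a0]. *)
have [a [Uab [c [ac ca]]]] : [set a | U (a, b)] `&` GL A !=set0.
  apply: GLdense; first by exists a0.
  apply: (@open_comp _ _ (fun a : A => (a, b))) => // a _.
  by apply: cvg_pair; [exact: cvg_id|exact: cvg_cst].
(* As [c] inverts [a], this set is the image under [bmul a] of the slice of [U] at [a]; written as a
   preimage, it is open by continuity of [bmul c]. *)
exists (bmul a b); rewrite /interior nbhsE; exists [set z | U (a, bmul c z)].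
  split; last by rewrite /= bmulA ca bmul1l.
  apply: (@open_comp _ _ (fun z : A => (a, bmul c z))) => // z _.
  by apply: cvg_pair; [exact: cvg_cst|exact: continuous_bmulr].
by move=> z Uz; exists (a, bmul c z) => //=; rewrite bmulA ac bmul1l.
Qed.

Theorem corollary4p3 (R : realType) :
  (forall A : unitalBanachAlgType R,
     dense (GL A) -> weakly_open_multiplication A) /\
  (forall A : unitalBanachAlgType R[i],
     dense (GL A) -> weakly_open_multiplication A).
Proof. by split=> A; exact: dense_GL_weakly_open_multiplication. Qed.
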